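(* Let $\mathbb{F}$ be a field of characteristic $2$, let $m\in\mathbb{N}$ and let $n=2m$. Let $H_m=\ker\epsilon_m/\operatorname{im}\epsilon_{m+2}$. The map $\theta:H_m\to H_m$ induced by restricting $\gamma_m\gamma_m^\star$ to $\ker\epsilon_m$ is a well-defined $\mathbb{F}S_n$-endomorphism of $H_m$ such that $\theta\ne 0$ and $\theta^2=0$.
   Context: For $k\in\mathbb{Z}$, $\Omega_k$ is the set of $k$-subsets of $\{1,\dots,n\}$ (empty if $k<0$ or $k>n$), and $\mathbb{F}\Omega_k$ is the permutation $\mathbb{F}S_n$-module with basis $\Omega_k$. Maps are written on the right and composed left to right. The $\mathbb{F}S_n$-homomorphisms $\gamma_k:\mathbb{F}\Omega_k\to\mathbb{F}\Omega_{k-1}$, $\epsilon_k:\mathbb{F}\Omega_k\to\mathbb{F}\Omega_{k-2}$ and $\gamma_k^\star:\mathbb{F}\Omega_{k-1}\to\mathbb{F}\Omega_k$ are defined by $Y\gamma_k=\sum_{X\subseteq Y,\,|X|=k-1}X$ and $Y\epsilon_k=\sum_{X\subseteq Y,\,|X|=k-2}X$ for $Y\in\Omega_k$, and $Y\gamma_k^\star=\sum_{Z\supseteq Y,\,|Z|=k}Z$ for $Y\in\Omega_{k-1}$. *)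

(* Defs.v *)
From HB Require Import structures.
From mathcomp Require Import all_boot all_order all_algebra all_fingroup.

Set Implicit Arguments.
Unset Strict Implicit.
Unset Printing Implicit Defensive.

Import GRing.Theory.
Local Open Scope ring_scope.
Local Open Scope quotient_scope.

(* The subquotient V / (U :&: V) of a vector space, i.e. V / U if U <= V.     *)
Section Subquotient.

Variables (F : fieldType) (W : vectType F) (V U : {vspace W}).

Definition subquot_pred : {pred subvs_of V} := [pred v | vsval v \in U].

Fact subquot_pred_zmod_closed : zmod_closed subquot_pred.
Proof.
split=> [|u v]; rewrite !inE ?linear0 ?mem0v // linearB => uU vU.
exact: rpredB.
Qed.

HB.instance Definition _ :=
  GRing.isZmodClosed.Build (subvs_of V) subquot_pred subquot_pred_zmod_closed.

Definition subquot : Type := Quotient.quot subquot_pred.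

HB.instance Definition _ := GRing.Zmodule.on subquot.

Definition subquot_class (v : subvs_of V) : subquot :=
  \pi_(Quotient.quot subquot_pred) v.

Definition subquot_repr (x : subquot) : subvs_of V :=
  generic_quotient.repr (x : Quotient.quot subquot_pred).

Lemma subquot_reprK : cancel subquot_repr subquot_class.
Proof. by move=> x; rewrite /subquot_class /subquot_repr reprK. Qed.

Lemma subquot_classP (u v : subvs_of V) :
  reflect (subquot_class u = subquot_class v) (vsval u - vsval v \in U).
Proof.
suff ->: (vsval u - vsval v \in U) = (subquot_class u == subquot_class v).
  exact: eqP.
by rewrite /subquot_class -Quotient.idealrBE !inE linearB.
Qed.

Lemma subquot_classD : {morph subquot_class : u v / u + v}.
Proof. by move=> u v; rewrite /subquot_class (Quotient.pi_add subquot_pred). Qed.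

Definition subquot_scale (a : F) (x : subquot) : subquot :=
  subquot_class (a *: subquot_repr x).

Lemma subquot_classZ a v :
  subquot_class (a *: v) = subquot_scale a (subquot_class v).
Proof.
apply/subquot_classP; rewrite !linearZ -scalerDr; apply: memvZ.
by apply/subquot_classP; rewrite subquot_reprK.
Qed.

Fact subquot_scaleA a b x :
  subquot_scale a (subquot_scale b x) = subquot_scale (a * b) x.
Proof. by rewrite -[x]subquot_reprK -!subquot_classZ scalerA. Qed.

Fact subquot_scale1 : left_id 1 subquot_scale.
Proof. by move=> x; rewrite -[x]subquot_reprK -!subquot_classZ scale1r. Qed.

Fact subquot_scaleDr : right_distributive subquot_scale +%R.
Proof.
move=> a x y; rewrite -[x]subquot_reprK -[y]subquot_reprK.
by rewrite -subquot_classD -!subquot_classZ scalerDr subquot_classD.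
Qed.

Fact subquot_scaleDl x : {morph subquot_scale^~ x : a b / a + b}.
Proof.
move=> a b; rewrite -[x]subquot_reprK.
by rewrite -!subquot_classZ scalerDl subquot_classD.
Qed.

HB.instance Definition _ := GRing.Zmodule_isLmodule.Build F subquot
  subquot_scaleA subquot_scale1 subquot_scaleDr subquot_scaleDl.

Fact subquot_class_is_linear : linear subquot_class.
Proof. by move=> a u v; rewrite subquot_classD subquot_classZ. Qed.

HB.instance Definition _ := GRing.isLinear.Build F (subvs_of V) subquot _
  subquot_class subquot_class_is_linear.

(* Well defined on classes only if f stabilizes both V and U.                 *)
Definition subquot_map (f : W -> W) (x : subquot) : subquot :=
  subquot_class (vsproj V (f (vsval (subquot_repr x)))).

Lemma subquot_mapE (f : {linear W -> W}) (v : subvs_of V) :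
    (forall w, w \in V -> f w \in V) -> (forall w, w \in U -> f w \in U) ->
  subquot_map f (subquot_class v) = subquot_class (vsproj V (f (vsval v))).
Proof.
move=> fV fU; apply/subquot_classP.
rewrite !vsprojK ?fV ?subvsP // -linearB; apply: fU.
by apply/subquot_classP; rewrite subquot_reprK.
Qed.

(* theta is the map of V / (U :&: V) induced by the restriction of f to V.    *)
Definition subquot_induced (f : W -> W) (theta : subquot -> subquot) : Prop :=
  forall v w : subvs_of V,
    vsval w = f (vsval v) -> theta (subquot_class v) = subquot_class w.

End Subquotient.

Section PermutationModules.

Variables (F : fieldType) (n : nat).
Implicit Types (i j k : int) (s t : 'S_n).

(* The ground set {1, ..., n} is encoded as 'I_n.                             *)
Definition Omega k : finType := {Y : {set 'I_n} | #|Y|%:Z == k}.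

Definition FOmega k : vectType F := {ffun Omega k -> F^o}.

Definition FOmega_basis k (Y : Omega k) : FOmega k :=
  [ffun X : Omega k => (X == Y)%:R : F^o].

Definition FOmega_ext_fun k (V : lmodType F) (f : Omega k -> V)
  (v : FOmega k) : V := \sum_(Y : Omega k) (v Y : F) *: f Y.

Fact FOmega_ext_is_linear k (V : lmodType F) (f : Omega k -> V) :
  linear (FOmega_ext_fun f).
Proof.
move=> a u v; rewrite /FOmega_ext_fun scaler_sumr -big_split /=.
by apply: eq_bigr => Y _; rewrite !ffunE scalerDl scalerA.
Qed.

HB.instance Definition _ k (V : lmodType F) (f : Omega k -> V) :=
  GRing.isLinear.Build F (FOmega k) V _ (FOmega_ext_fun f)
    (FOmega_ext_is_linear f).

Definition FOmega_ext k (V : vectType F) (f : Omega k -> V) :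
  'Hom(FOmega k, V) := linfun (FOmega_ext_fun f).

Lemma FOmega_basisE k (v : FOmega k) :
  v = \sum_(Y : Omega k) (v Y : F) *: FOmega_basis Y.
Proof.
apply/ffunP=> X; rewrite sum_ffunE (bigD1 X) //= big1 ?addr0.
  by rewrite !ffunE eqxx [_ *: _]mulr1.
by move=> Y neYX; rewrite !ffunE eq_sym (negPf neYX) scaler0.
Qed.

Lemma FOmega_ext_basis k (V : vectType F) (f : Omega k -> V) (Y : Omega k) :
  FOmega_ext f (FOmega_basis Y) = f Y.
Proof.
rewrite lfunE /= /FOmega_ext_fun (bigD1 Y) //= big1 ?addr0.
  by rewrite ffunE eqxx scale1r.
by move=> X neXY; rewrite ffunE (negPf neXY) scale0r.
Qed.

Lemma FOmega_lfunP k (V : vectType F) (f g : 'Hom(FOmega k, V)) :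
  (forall Y : Omega k, f (FOmega_basis Y) = g (FOmega_basis Y)) -> f = g.
Proof.
move=> eqfg; apply/lfunP=> v; rewrite [v]FOmega_basisE !linear_sum.
by apply: eq_bigr => Y _; rewrite !linearZ /= eqfg.
Qed.

Definition shadow i j : 'Hom(FOmega i, FOmega j) :=
  FOmega_ext (fun Y : Omega i =>
    \sum_(X : Omega j | val X \subset val Y) FOmega_basis X).

Definition gamma k : 'Hom(FOmega k, FOmega (k - 1)) := shadow k (k - 1).

Definition epsilon k : 'Hom(FOmega k, FOmega (k - 2)) := shadow k (k - 2).

Definition gamma_star k : 'Hom(FOmega (k - 1), FOmega k) :=
  FOmega_ext (fun Y : Omega (k - 1) =>
    \sum_(Z : Omega k | val Y \subset val Z) FOmega_basis Z).

(* The image of epsilon (k + 2), transported from FOmega (k + 2 - 2) to       *)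
(* FOmega k.                                                                  *)
Definition im_epsilon k : {vspace FOmega k} :=
  ecast l {vspace FOmega l} (addrK 2 k) (limg (epsilon (k + 2))).

Lemma im_epsilonE k : im_epsilon k = limg (shadow (k + 2) k).
Proof.
rewrite /im_epsilon /epsilon.
by move: (addrK 2 k) => /=; move: (k + 2) => i; case: k /.
Qed.

Definition H k : lmodType F := subquot (lker (epsilon k)) (im_epsilon k).

Fact Omega_act_subproof k (Y : Omega k) s : #|s @: val Y|%:Z == k.
Proof. by rewrite card_imset; [exact: (valP Y) | exact: perm_inj]. Qed.

Definition Omega_act_fun k (Y : Omega k) s : Omega k :=
  exist _ (s @: val Y) (Omega_act_subproof Y s).

Fact Omega_act1 k : (@Omega_act_fun k)^~ 1%g =1 id.
Proof.
move=> Y; apply: val_inj => /=; rewrite -[RHS]imset_id.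
by apply: eq_imset => x; rewrite perm1.
Qed.

Fact Omega_actM k (Y : Omega k) : act_morph (@Omega_act_fun k) Y.
Proof.
move=> s t; apply: val_inj => /=; rewrite -imset_comp.
by apply: eq_imset => x; rewrite permM.
Qed.

Definition Omega_act k : {action 'S_n &-> Omega k} :=
  TotalAction (@Omega_act1 k) (@Omega_actM k).

Definition FOmega_perm k s : 'Hom(FOmega k, FOmega k) :=
  FOmega_ext (fun Y : Omega k => FOmega_basis (Omega_act k Y s)).

Lemma FOmega_perm1 k : FOmega_perm k 1%g = \1%VF.
Proof.
by apply: FOmega_lfunP => Y; rewrite FOmega_ext_basis act1 id_lfunE.
Qed.

Lemma FOmega_permM k s t :
  FOmega_perm k (s * t)%g = (FOmega_perm k t \o FOmega_perm k s)%VF.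
Proof.
by apply: FOmega_lfunP => Y; rewrite comp_lfunE !FOmega_ext_basis actM.
Qed.

Fact FOmega_act1 k : (fun v : FOmega k => FOmega_perm k ^~ v)^~ 1%g =1 id.
Proof. by move=> v; rewrite FOmega_perm1 id_lfunE. Qed.

Fact FOmega_actM k (v : FOmega k) :
  act_morph (fun v : FOmega k => FOmega_perm k ^~ v) v.
Proof. by move=> s t; rewrite FOmega_permM comp_lfunE. Qed.

Definition FOmega_act k : {action 'S_n &-> FOmega k} :=
  TotalAction (@FOmega_act1 k) (@FOmega_actM k).

Lemma shadow_act i j (v : FOmega i) s :
  shadow i j (FOmega_act i v s) = FOmega_act j (shadow i j v) s.
Proof.
suff eqf : (shadow i j \o FOmega_perm i s = FOmega_perm j s \o shadow i j)%VF.
  by have /lfunP/(_ v) := eqf; rewrite !comp_lfunE.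
apply: FOmega_lfunP => Y; rewrite !comp_lfunE !FOmega_ext_basis linear_sum /=.
rewrite (reindex_inj (act_inj (Omega_act j) s)) /=.
apply: eq_big => [X|X _]; last by rewrite FOmega_ext_basis.
apply/idP/idP; last exact: imsetS.
move=> /subsetP sXY; apply/subsetP=> x /(imset_f s) /sXY /imsetP[y yY].
by move/perm_inj->.
Qed.

Lemma lker_epsilon_act k s v :
  v \in lker (epsilon k) -> FOmega_perm k s v \in lker (epsilon k).
Proof.
rewrite !memv_ker => /eqP ev0; have /= -> := shadow_act (k - 2) v s.
by rewrite [shadow _ _ v]ev0 linear0.
Qed.

Lemma im_epsilon_act k s v :
  v \in im_epsilon k -> FOmega_perm k s v \in im_epsilon k.
Proof.
rewrite im_epsilonE => /memv_imgP[u _ ->].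
by have /= <- := shadow_act k u s; rewrite memv_img ?memvf.
Qed.

Definition H_act_fun k (x : H k) s : H k := subquot_map (FOmega_perm k s) x.

Lemma H_act_class k (v : subvs_of (lker (epsilon k))) s :
  H_act_fun (subquot_class (im_epsilon k) v) s =
    subquot_class (im_epsilon k)
      (vsproj (lker (epsilon k)) (FOmega_act k (vsval v) s)).
Proof.
by apply: subquot_mapE; [exact: lker_epsilon_act | exact: im_epsilon_act].
Qed.

Fact H_act1 k : (@H_act_fun k)^~ 1%g =1 id.
Proof.
by move=> x; rewrite -[x]subquot_reprK H_act_class /= FOmega_perm1 id_lfunE vsvalK.
Qed.

Fact H_actM k (x : H k) : act_morph (@H_act_fun k) x.
Proof.
move=> s t; rewrite -[x]subquot_reprK !H_act_class /=.
by rewrite FOmega_permM comp_lfunE vsprojK ?lker_epsilon_act ?subvsP.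
Qed.

Definition H_act k : {action 'S_n &-> H k} :=
  TotalAction (@H_act1 k) (@H_actM k).

Lemma H_act_is_linear k s : linear (fun x : H k => H_act k x s).
Proof.
move=> a x y; rewrite -[x]subquot_reprK -[y]subquot_reprK -linearP.
rewrite /= !H_act_class -linearP /= -linearP /=.
by rewrite linearP /= linearP.
Qed.

(* An F S_n-homomorphism: F-linearity is in the type of f.                    *)
Definition FSn_hom (V W : lmodType F) (toV : {action 'S_n &-> V})
    (toW : {action 'S_n &-> W}) (f : {linear V -> W}) : Prop :=
  forall (v : V) s, f (toV v s) = toW (f v) s.

End PermutationModules.

(* Main.v *)
(* Write d = gamma and u = gamma_star. On FOmega k, "u after d" equals
   c + sum_(a < b) ((a b) - 1) with c = k + k (n - k), an element of the group
   algebra, so it stabilizes every submodule and is compatible with every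
   homomorphism between the FOmega k. For n = 2m the constants c on levels m and
   m - 1 differ by 2, hence d u d = (u d) d, which vanishes since d d = 0 in
   characteristic 2; so (u d)^2 = 0 already on FOmega m.

   For theta != 0, let M and N be the two perfect matchings of a Hamiltonian
   cycle 0, ..., 2m - 1, and let v (resp. w) be the sum of the transversals of M
   (resp. N) containing 0. Exchanging the two ends of an edge shows that epsilon
   kills v and that w is orthogonal to im epsilon. The pairing of u d v with w
   equals that of d v with d w, which counts the common transversals of M and N
   containing 0: the even numbers are the only one, so u d v is not in
   im epsilon. *)
Require Import Defs.
From HB Require Import structures.
From mathcomp Require Import all_boot all_order all_algebra all_fingroup.
From mathcomp Require Import zify.

Set Implicit Arguments.
Unset Strict Implicit.
Unset Printing Implicit Defensive.

Import GRing.Theory.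
Local Open Scope ring_scope.

(** * Cancellation in characteristic 2, double counting and transpositions of sets *)

(** As [g] flips [p], it matches the terms where [p] holds with equal terms where it fails. *)
Lemma sum_involution_pchar2 (R : nzRingType) (T : finType) (P p : pred T)
    (g : T -> T) (f : T -> R) :
    2%N \in [pchar R] ->
    (forall x, P x ->
      [/\ P (g x), g (g x) = x, p (g x) = ~~ p x & f (g x) = f x]) ->
  \sum_(x | P x) f x = 0.
Proof.
move=> char2 gP; rewrite (bigID p) /=.
rewrite [X in _ + X](reindex_onto g g) /=; last first.
  by move=> x /andP[/gP[]].
rewrite [X in _ + X](_ : _ = \sum_(x | P x && p x) f x) ?addrr_pchar2 //.
apply: eq_big => [x|x /andP[/andP[/gP[Px gK _ _]]]].
  apply/idP/idP => [/andP[/andP[/gP[Pg gK pg _]] pgN /eqP ggx]|].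
    by rewrite ggx in Pg pg; rewrite Pg pg.
  case/andP=> Px px; have [-> -> -> _] := gP x Px.
  by rewrite px eqxx.
by move=> pg /eqP ggx; rewrite ggx in Px; have [] := gP _ Px.
Qed.

(** By symmetry the left side runs over unordered pairs; only those separated by [A] survive, and
    each is listed with its end in [A] first. *)
Lemma sum_ltn_cut (V : nmodType) n (A : {set 'I_n}) (g : 'I_n -> 'I_n -> V) :
    (forall a b, g a b = g b a) ->
    (forall a b, (a \in A) = (b \in A) -> g a b = 0) ->
  \sum_(p : 'I_n * 'I_n | (p.1 < p.2)%N) g p.1 p.2 =
    \sum_(a in A) \sum_(b in ~: A) g a b.
Proof.
move=> gC g0; rewrite pair_big /=.
rewrite (bigID (fun p : 'I_n * 'I_n => p.1 \in A)).
rewrite [RHS](bigID (fun p : 'I_n * 'I_n => p.1 < p.2)%N) /=; congr (_ + _).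
  rewrite [LHS]big_mkcond [RHS]big_mkcond /=; apply: eq_bigr => -[a b] _ /=.
  have := g0 a b; rewrite inE.
  by case: (a \in A); case: (b \in A); case: (a < b)%N => //= ->.
rewrite [RHS](reindex_inj (h := fun p => (p.2, p.1))) /=; last first.
  by move=> [a b] [c d] [-> ->].
rewrite [LHS]big_mkcond [RHS]big_mkcond /=; apply: eq_bigr => -[a b] _ /=.
rewrite inE (gC b a); have := g0 a b.
case: ltngtP => [_|_|/val_inj->]; last by move=> ->; rewrite // if_same.
  by case: (a \in A); case: (b \in A) => //= ->.
by rewrite andbF !andFb.
Qed.

(** A subset with one element fewer than [B] misses exactly one point of [B], so summing over the
    missing point changes nothing. *)
Lemma sum_setD1 (V : nmodType) (T : finType) (B : {set T}) c
    (f : {set T} -> V) :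
    #|B| = c.+1 ->
  \sum_(A : {set T} | (#|A| == c) && (A \subset B)) f A =
    \sum_(x in B) f (B :\ x).
Proof.
move=> cB.
transitivity (\sum_(x in B) \sum_(A : {set T} |
    [&& #|A| == c, A \subset B & x \notin A]) f A); last first.
  apply: eq_bigr => x xB; rewrite (big_pred1 (B :\ x)) // => A.
  apply/and3P/eqP => [[/eqP cA sAB xA]|->]; last first.
    have := cardsD1 x B; rewrite xB cB add1n => -[<-].
    by rewrite subD1set setD11.
  apply/eqP; rewrite eqEcard subsetD1 sAB xA /=.
  by have := cardsD1 x B; rewrite xB cB add1n cA => -[<-].
rewrite (exchange_big_dep
  (fun A : {set T} => (#|A| == c) && (A \subset B))) /=; last first.
  by move=> x A _ /and3P[-> ->].
transitivity (\sum_(A : {set T} | (#|A| == c) && (A \subset B))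
    \sum_(x in B :\: A) f A).
  apply: eq_bigr => A /andP[/eqP cA sAB].
  by rewrite sumr_const cardsD (setIidPr sAB) cB cA subSnn.
apply: eq_bigr => A /andP[-> ->] /=.
by apply: eq_bigl => x; rewrite inE andbC.
Qed.

(** Turns an inclusion test into a sum over points: only the single element of [B :\: A] can
    complete [A] to [B]. *)
Lemma sum_setU1_eq (R : nzSemiRingType) (T : finType) (A B : {set T}) :
    #|B| = #|A|.+1 ->
  \sum_(x in ~: A) (B == x |: A)%:R = (A \subset B)%:R :> R.
Proof.
move=> cB; have [sAB|nsAB] := boolP (A \subset B); last first.
  rewrite big1 // => x _; case: eqP => // eB.
  by rewrite eB subsetUr in nsAB.
have /cards1P[x eBA] : #|B :\: A| == 1%N.
  by rewrite cardsD (setIidPr sAB) cB subSnn.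
have /setDP[xB xA] : x \in B :\: A by rewrite eBA set11.
have eB : B = x |: A by rewrite -(setID B A) (setIidPr sAB) eBA setUC.
rewrite (bigD1 x) ?inE //= {1}eB eqxx big1 ?addr0 // => y /andP[].
rewrite inE => yA neyx; case: eqP => // eBy.
have : y \in B by rewrite eBy setU11.
by rewrite eB !inE (negPf neyx) (negPf yA).
Qed.

Lemma imset_tperm_out (T : finType) (A : {set T}) a b :
  a \in A -> b \notin A -> tperm a b @: A = b |: A :\ a.
Proof.
move=> aA bA; apply/setP=> x; rewrite -[x in LHS](tpermK a b).
rewrite mem_imset; last exact: perm_inj.
rewrite !inE; case: tpermP => [->|->|/eqP nxa /eqP nxb].
- by rewrite (negPf bA) eqxx orbF; apply/esym/negP => /eqP eab; rewrite -eab aA in bA.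
- by rewrite aA eqxx.
by rewrite nxa (negPf nxb).
Qed.

Lemma imset_tperm_id (T : finType) (A : {set T}) a b :
  (a \in A) = (b \in A) -> tperm a b @: A = A.
Proof.
move=> eab; apply/setP=> x; rewrite -[x in LHS](tpermK a b).
rewrite mem_imset; last exact: perm_inj.
by case: tpermP => [->|->|//]; rewrite eab.
Qed.

(** * Incidence maps in coordinates, and [gamma_star] after [gamma] in the group algebra *)

Section PermutationModuleMaps.

Variables (F : fieldType) (n : nat).
Implicit Types (i j k : int) (s : 'S_n) (A B : {set 'I_n}).

Lemma FOmega_ext_incidence i j (r : Omega n j -> Omega n i -> bool)
    (v : FOmega F n i) (X : Omega n j) :
  FOmega_ext (fun Y => \sum_(X0 | r X0 Y) FOmega_basis F X0) v X =
    \sum_(Y | r X Y) (v Y : F).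
Proof.
rewrite lfunE /= /FOmega_ext_fun sum_ffunE [RHS]big_mkcond /=.
apply: eq_bigr => Y _; rewrite !ffunE sum_ffunE.
case: ifP => rXY; last first.
  rewrite big1 ?scaler0 // => Z rZY; rewrite ffunE; case: eqP => // eXZ.
  by rewrite eXZ rZY in rXY.
rewrite (bigD1 X) //= big1 ?addr0; first by rewrite ffunE eqxx [_ *: _]mulr1.
by move=> Z /andP[_ neZ]; rewrite ffunE eq_sym (negPf neZ).
Qed.

Lemma shadowE i j (v : FOmega F n i) (X : Omega n j) :
  shadow F n i j v X = \sum_(Y : Omega n i | val X \subset val Y) (v Y : F).
Proof. exact: (FOmega_ext_incidence (fun X Y => val X \subset val Y)). Qed.

Lemma gamma_starE k (v : FOmega F n (k - 1)) (X : Omega n k) :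
  gamma_star F n k v X =
    \sum_(Y : Omega n (k - 1) | val Y \subset val X) (v Y : F).
Proof. exact: (FOmega_ext_incidence (fun X Y => val Y \subset val X)). Qed.

Lemma gamma_star_act k (v : FOmega F n (k - 1)) s :
  gamma_star F n k (FOmega_act F n (k - 1) v s) =
    FOmega_act F n k (gamma_star F n k v) s.
Proof.
suff /lfunP/(_ v) : (gamma_star F n k \o FOmega_perm F (k - 1) s =
    FOmega_perm F k s \o gamma_star F n k)%VF by rewrite !comp_lfunE.
apply: FOmega_lfunP => Y; rewrite !comp_lfunE !FOmega_ext_basis linear_sum /=.
rewrite (reindex_inj (act_inj (Omega_act n k) s)) /=.
apply: eq_big => [Z|Z _]; last by rewrite FOmega_ext_basis.
apply/idP/idP; last exact: imsetS.
move=> /subsetP sYZ; apply/subsetP=> x /(imset_f s) /sYZ /imsetP[y yZ].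
by move/perm_inj->.
Qed.

Lemma big_Omega (V : nmodType) k (P : pred {set 'I_n}) (f : {set 'I_n} -> V) :
  \sum_(X : Omega n k | P (val X)) f (val X) =
    \sum_(A : {set 'I_n} | (#|A|%:Z == k) && P A) f A.
Proof.
rewrite [RHS](reindex_omap (val : Omega n k -> _) insub) /=.
  by apply: eq_bigl => X; rewrite valK eqxx andbT (valP X).
by move=> A /andP[cA _]; rewrite insubT.
Qed.

Lemma card_Omega k (X : Omega n k) : #|val X| = `|k|%N.
Proof. by have /eqP/(congr1 absz) := valP X. Qed.

(** The coefficient of [X] in the image of [Y] counts the sets [W] of size [j] between them. Equal
    steps make complementation in this interval preserve that size, so the count is even. *)
Lemma shadow_comp_eq0 i j k :
    2%N \in [pchar F] -> i - j = j - k -> 0 < j - k ->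
  (shadow F n j k \o shadow F n i j = 0)%VF.
Proof.
move=> char2 eq_ijk lt_kj; apply: FOmega_lfunP => Y.
rewrite comp_lfunE zero_lfunE.
apply/ffunP=> X; rewrite ffunE shadowE.
have [sXY|nsXY] := boolP (val X \subset val Y); last first.
  rewrite big1 // => W sXW; rewrite shadowE big1 // => Z sWZ.
  rewrite ffunE; case: eqP => // eZY.
  by case/negP: nsXY; rewrite -eZY (subset_trans sXW).
(* The point [a] lies in exactly one of [W] and its complement, so no [W] is fixed. *)
have [a Ya nXa] : exists2 a, a \in val Y & a \notin val X.
  apply/subsetPn; apply: contraL lt_kj => /subset_leq_card.
  have := eqP (valP X); have := eqP (valP Y).
  by move: #|val Y| #|val X| => y x; lia.
transitivity (\sum_(W : Omega n j |
    (val X \subset val W) && (val W \subset val Y)) (1 : F)).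
  rewrite big_mkcondr; apply: eq_bigr => W _; rewrite shadowE big_mkcond /=.
  rewrite (bigD1 Y) //= ffunE eqxx big1 ?addr0 // => Z neZY.
  by rewrite ffunE (negPf neZY) if_same.
pose P A := (val X \subset A) && (A \subset val Y).
rewrite (big_Omega _ P (fun=> 1)).
(* Complementation of W inside the interval [X, Y]. *)
apply: (@sum_involution_pchar2 _ _ _ (fun A => a \in A)
  (fun A => val X :|: (val Y :\: A))) => // A /and3P[cA sXA sAY].
have XY x : x \in val X -> x \in val Y by move/(subsetP sXY).
have XA x : x \in val X -> x \in A by move/(subsetP sXA).
have AY x : x \in A -> x \in val Y by move/(subsetP sAY).
split=> //; last by rewrite !inE (negPf nXa) Ya andbT.
  rewrite /P subsetUl subUset sXY subsetDl !andbT cardsU cardsD.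
  rewrite (_ : _ :&: (_ :\: _) = set0) ?(setIidPr sAY) ?cards0; last first.
    by apply/setP=> x; rewrite !inE; apply/negP=> /and3P[/XA ->].
  have := subset_leq_card sAY; have := subset_leq_card sXA.
  have := eqP (valP X); have := eqP (valP Y); move: cA.
  by move: #|val Y| #|val X| #|A| => y x z; lia.
apply/setP=> x; rewrite !inE.
have [Xx|_] /= := boolP (x \in val X); first by rewrite XA.
by have [/AY->|_] //= := boolP (x \in A); case: (x \in val Y).
Qed.

(** Removing [a] from [Y] and adding a point either restores [Y], once for each [a], or swaps [a]
    with some [b] outside [Y]. Transpositions not separated by [Y] contribute 0. For [k < 0] or
    [k > n] there is no basis vector, so the absolute values and the truncated subtraction are
    harmless. *)
Lemma gamma_star_gammaE k :
  (gamma_star F n k \o gamma F n k)%VF =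
    ((`|k| + `|k| * (n - `|k|))%N%:R : F) *: \1%VF +
      \sum_(p : 'I_n * 'I_n | (p.1 < p.2)%N)
        (FOmega_perm F k (tperm p.1 p.2) - \1%VF).
Proof.
apply: FOmega_lfunP => Y; rewrite comp_lfunE add_lfunE scale_lfunE sum_lfunE.
rewrite id_lfunE; apply/ffunP=> Z; rewrite gamma_starE !ffunE sum_ffunE.
pose e (A : {set 'I_n}) : F := (val Z == A)%:R.
have cY := card_Omega Y; have cZ := card_Omega Z.
transitivity (`|k|%:R * e (val Y) + \sum_(a in val Y) \sum_(b in ~: val Y)
    e (tperm a b @: val Y)); last first.
  (* The part [k * (n - k)] of the constant offsets one [- e (val Y)] per separated pair. *)
  transitivity ((`|k| + `|k| * (n - `|k|))%N%:R * e (val Y) +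
    \sum_(a in val Y) \sum_(b in ~: val Y) (e (tperm a b @: val Y) - e (val Y))).
    rewrite natrD mulrDl -addrA; congr (_ + _).
    under [in RHS]eq_bigr => a _ do rewrite big_split sumr_const /=.
    rewrite big_split /= sumr_const cY cardsCs setCK card_ord cY.
    by rewrite -mulrnA mulNrn mulr_natl mulnC addrC subrK.
  rewrite -(sum_ltn_cut (A := val Y)) => [|a b|a b eab].
  - congr (_ + _); apply: eq_bigr => -[a b] _ /=.
    by rewrite add_lfunE opp_lfunE id_lfunE FOmega_ext_basis !ffunE -!val_eqE.
  - by rewrite tpermC.
  by rewrite imset_tperm_id ?subrr.
(* In size 0 both sides vanish: [Y] is empty and no set has size -1. *)
case def_k: `|k|%N => [|c].
  rewrite mul0r add0r (_ : val Y = set0) ?big_set0; last first.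
    by apply: cards0_eq; rewrite cY.
  rewrite big_pred0 // => X; have := eqP (valP X); lia.
transitivity (\sum_(X : Omega n (k - 1) | val X \subset val Y)
    ((val X \subset val Z)%:R : F)).
  rewrite big_mkcond [RHS]big_mkcond; apply: eq_bigr => X _.
  rewrite shadowE [in LHS]big_mkcond (bigD1 Y) //= big1 => [|W neWY]; last first.
    by rewrite ffunE (negPf neWY) if_same.
  by rewrite ffunE eqxx addr0; case: ifP; case: ifP.
have k_ge0 : k = `|k|%N by have := eqP (valP Y); lia.
rewrite (big_Omega (k - 1) (fun A => A \subset val Y)
  (fun A => (A \subset val Z)%:R : F)).
rewrite (eq_bigl (fun A : {set 'I_n} => (#|A| == c) && (A \subset val Y))); last first.
  by move=> A; congr (_ && _); move: #|A| => x; lia.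
rewrite sum_setD1 ?cY // mulr_natl -def_k -cY -sumr_const -big_split /=.
(* Expand over the point added to [Y] minus [a]: adding [a] restores [Y], any other point gives a
   transposed set. *)
apply: eq_bigr => a Ya; rewrite -sum_setU1_eq; last first.
  by rewrite cZ -cY (cardsD1 a) Ya.
rewrite (bigD1 a) ?setD1K //=; last by rewrite !inE eqxx.
congr (_ + _); apply: eq_big => [b|b]; rewrite !inE.
  rewrite negb_and negbK; have [->|_] := eqVneq b a; last by rewrite andbT.
  by rewrite andbF [a \in _]Ya.
rewrite negb_and negbK => /andP[/orP[/eqP->|Yb _]]; first by rewrite eqxx.
by rewrite imset_tperm_out // ?inE.
Qed.

(** The operator is a combination of permutations, so the kernel and the image of [epsilon] are
    treated alike. *)
Lemma gamma_star_gamma_stable k (U : {vspace FOmega F n k}) :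
    (forall s v, v \in U -> FOmega_perm F k s v \in U) ->
  ((gamma_star F n k \o gamma F n k)%VF @: U <= U)%VS.
Proof.
move=> stabU; apply/subvP=> _ /memv_imgP[v Uv ->].
rewrite gamma_star_gammaE add_lfunE scale_lfunE sum_lfunE id_lfunE.
rewrite rpredD ?rpredZ // rpred_sum // => p _.
by rewrite add_lfunE opp_lfunE id_lfunE rpredB ?stabU.
Qed.

Lemma gamma_star_gamma_act k (v : FOmega F n k) s :
  (gamma_star F n k \o gamma F n k)%VF (FOmega_perm F k s v) =
    FOmega_perm F k s ((gamma_star F n k \o gamma F n k)%VF v).
Proof.
rewrite !comp_lfunE; have /= -> := shadow_act (k - 1) v s.
exact: gamma_star_act.
Qed.

Lemma gamma_star_gamma_sqr (m : nat) :
    2%N \in [pchar F] -> (0 < m)%N -> n = (2 * m)%N ->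
  let phi := (gamma_star F n m \o gamma F n m)%VF in (phi \o phi = 0)%VF.
Proof.
move=> char2 m_gt0 def_n phi; apply/lfunP=> v.
rewrite zero_lfunE comp_lfunE.
(* Each transposition commutes with [gamma], so only the two constants need comparing. *)
have comm : gamma F n m (phi v) =
    (gamma_star F n (m%:Z - 1) \o gamma F n (m%:Z - 1))%VF (gamma F n m v).
  rewrite /phi !gamma_star_gammaE !add_lfunE !scale_lfunE !sum_lfunE !id_lfunE.
  rewrite linearD linearZ linear_sum; congr (_ + _).
    congr (_ *: _); have -> : `|m%:Z - 1|%N = m.-1 by lia.
    (* With [n = 2 * m], [m + m * m] exceeds [(m - 1) + (m - 1) * (m + 1)] by 2. *)
    have -> : (`|m%:Z| + `|m%:Z| * (n - `|m%:Z|) =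
        m.-1 + m.-1 * (n - m.-1) + 2)%N.
      by rewrite def_n; case: m m_gt0 {def_n phi v} => // m _; rewrite /=; nia.
    by rewrite natrD (pcharf0 char2) addr0.
  apply: eq_bigr => p _; rewrite !add_lfunE !opp_lfunE !id_lfunE linearB.
  by congr (_ - _); have /= -> := shadow_act (m%:Z - 1) v (tperm p.1 p.2).
rewrite [phi (phi v)]comp_lfunE comm comp_lfunE -[gamma F n (m%:Z - 1) _]comp_lfunE.
by rewrite shadow_comp_eq0 // ?zero_lfunE ?linear0 //; lia.
Qed.

Lemma im_epsilon_sub_ker k :
  2%N \in [pchar F] -> (im_epsilon F n k <= lker (epsilon F n k))%VS.
Proof.
move=> char2; rewrite im_epsilonE; apply/subvP=> _ /memv_imgP[v _ ->].
by rewrite memv_ker -comp_lfunE shadow_comp_eq0 ?zero_lfunE //; lia.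
Qed.

End PermutationModuleMaps.

(** * Transversals of a perfect matching *)

Section Transversals.

Variables (T : finType) (t : T -> T) (tK : involutive t).
Hypothesis t_neq : forall x, t x != x.
Implicit Types (A B X : {set T}).

(** The orbits of [t] are the edges of the matching; [A] picks one end of each. *)
Definition transverse A := [forall x, (t x \in A) == (x \notin A)].

Lemma transverseP A :
  reflect (forall x, (t x \in A) = (x \notin A)) (transverse A).
Proof. by apply: (iffP forallP) => AP x; apply/eqP. Qed.

(** The involution maps [A] onto its complement. *)
Lemma card_transverse A : transverse A -> (2 * #|A|)%N = #|T|.
Proof.
move/transverseP=> tA; rewrite mul2n -addnn -{2}(card_imset A (inv_inj tK)).
rewrite -(cardsC A); congr (_ + _)%N; apply: eq_card => x.
by rewrite inE -tA -[in LHS](tK x) mem_imset //; apply: inv_inj.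
Qed.

(** The transposition of [x] and [t x] commutes with [t]. *)
Lemma transverse_tperm A x :
  transverse A -> transverse (tperm x (t x) @: A).
Proof.
move/transverseP=> tA; apply/transverseP=> y.
rewrite -[y in RHS](tpermK x (t x)) -[t y](tpermK x (t x)).
rewrite !mem_imset; try exact: perm_inj.
rewrite -tA; congr (_ \in A).
have [->|->|nyx nyt] := tpermP x (t x) y; rewrite ?tK ?tpermR ?tpermL //.
by rewrite tpermD // eq_sym; apply/eqP => /(congr1 t); rewrite ?tK // => /esym.
Qed.

(** If [X] picks one end of every edge other than that of [a], forcing [a] in and [t a] out settles
    the last edge. *)
Lemma transverse_dichotomy a X :
    (exists x, [/\ x != a, x != t a & (t x \in X) = (x \in X)]) \/
  transverse (a |: X :\ a :\ t a).
Proof.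
have [/existsP[x /and3P[xa xta /eqP xX]]|] :=
    boolP [exists x, [&& x != a, x != t a & (t x \in X) == (x \in X)]].
  by left; exists x.
rewrite negb_exists => /forallP noX; right; apply/transverseP => x.
have := noX x; rewrite !inE.
have [->|xa] := eqVneq x a; first by rewrite !eqxx (negPf (t_neq a)).
have [->|xta] := eqVneq x (t a); first by rewrite tK !eqxx.
rewrite (inj_eq (inv_inj tK)) (negPf xa) (can2_eq tK tK) (negPf xta) /=.
by case: (t x \in X); case: (x \in X).
Qed.

End Transversals.

(** * The sum of the transversals through a base point *)

Section TransversalVector.

Variables (F : fieldType) (char2 : 2%N \in [pchar F]) (m n : nat).
Hypotheses (m_gt0 : (0 < m)%N) (def_n : n = (2 * m)%N).
Variables (t : 'I_n -> 'I_n) (tK : involutive t).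
Hypothesis t_neq : forall x, t x != x.
Variable a : 'I_n.
Implicit Types (A B X : {set 'I_n}).

Definition transverse_vector : FOmega F n m :=
  [ffun Y : Omega n m => ((a \in val Y) && transverse t (val Y))%:R : F^o].

(** Swapping the ends of the edge of [x] keeps [a] but toggles [x], so the transversals cancel in
    pairs. *)
Lemma transverse_vector_sum0 (P : pred {set 'I_n}) x :
    x != a -> x != t a -> (forall A, P A -> P (tperm x (t x) @: A)) ->
  \sum_(Y : Omega n m | P (val Y)) (transverse_vector Y : F) = 0.
Proof.
move=> xa xta PP; under eq_bigr do rewrite ffunE.
rewrite (big_Omega _ P (fun A => ((a \in A) && transverse t A)%:R : F)).
under eq_bigr do rewrite mulrb.
rewrite -big_mkcondr.
apply: (sum_involution_pchar2 (p := fun A => x \in A)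
  (g := fun A => tperm x (t x) @: A)) => // A /and3P[/andP[cA PA] aA tA].
have mem B y : (y \in tperm x (t x) @: B) = (tperm x (t x) y \in B).
  by rewrite -[y in LHS](tpermK x (t x)) mem_imset //; apply: perm_inj.
split=> //; last by rewrite mem tpermL; apply/transverseP.
  rewrite card_imset ?cA; last exact: perm_inj.
  rewrite PP // transverse_tperm // mem tpermD ?aA //.
  by rewrite (can2_eq tK tK).
by apply/setP=> y; rewrite !mem tpermK.
Qed.

Lemma transverse_vector_sum_stable X x :
    x != a -> x != t a -> (t x \in X) = (x \in X) ->
    \sum_(Y : Omega n m | X \subset val Y) (transverse_vector Y : F) = 0 /\
    \sum_(Y : Omega n m | val Y \subset X) (transverse_vector Y : F) = 0.
Proof.
move=> xa xta xX; have XX := imset_tperm_id (esym xX).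
split.
  apply: (transverse_vector_sum0 (P := fun A => X \subset A) xa xta) => A sXA.
  by rewrite -XX imsetS.
apply: (transverse_vector_sum0 (P := fun A => A \subset X) xa xta) => A sAX.
by rewrite -XX imsetS.
Qed.

Lemma card_setD1D1 X : (#|X :\ a :\ t a| <= #|X| <= #|X :\ a :\ t a| + 2)%N.
Proof.
rewrite [#|X|](cardsD1 a) [#|X :\ a|](cardsD1 (t a)).
by case: (a \in X); case: (t a \in _); move: #|_| => c /=; lia.
Qed.

(** If [X] met each edge off [a] once, it would have [m - 1] points there, hence between [m - 1] and
    [m + 1] in all. The sizes [m - 2] and [m + 2] are the ones needed for [epsilon]. *)
Lemma transverse_vector_sum_far X :
    (#|X| + 1 < m)%N || (m + 1 < #|X|)%N ->
    \sum_(Y : Omega n m | X \subset val Y) (transverse_vector Y : F) = 0 /\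
    \sum_(Y : Omega n m | val Y \subset X) (transverse_vector Y : F) = 0.
Proof.
move=> farX; have [[x [xa xta xX]]|] := transverse_dichotomy tK t_neq a X.
  exact: transverse_vector_sum_stable xX.
move/(card_transverse tK); rewrite card_ord cardsU1 !inE eqxx andbF /=.
have := card_setD1D1 X; move: #|_| #|_| farX => c d; lia.
Qed.

Lemma gamma_transverse_vector (X : Omega n (m%:Z - 1)) :
  gamma F n m transverse_vector X =
    ((a \notin val X) && transverse t (a |: val X))%:R.
Proof.
have cX : #|val X| = m.-1 by rewrite card_Omega; lia.
rewrite shadowE; have [[x [xa xta xX]]|] := transverse_dichotomy tK t_neq a (val X).
  have [-> _] := transverse_vector_sum_stable xa xta xX.
  (* An edge with both ends or neither in [X] also keeps [a |: val X] from being transverse. *)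
  case: transverseP => [/(_ x)|_]; last by rewrite andbF.
  rewrite !inE (negPf xa) (can2_eq tK tK) (negPf xta) xX.
  by case: (x \in val X).
move=> tX; have := card_transverse tK tX.
rewrite card_ord cardsU1 !inE eqxx andbF /= => cX'.
(* Off the edge of [a], [X] already has all of its [m - 1] points. *)
have eX : val X :\ a :\ t a = val X.
  apply/eqP; rewrite eqEcard cX (subset_trans (subsetDl _ _)) ?subsetDl //=.
  move: cX'; move: #|_| => c; lia.
have nXa : a \notin val X by rewrite -eX !inE eqxx andbF.
rewrite eX in tX; rewrite nXa tX /=.
have cY : #|a |: val X|%:Z == m by rewrite cardsU1 nXa cX; lia.
pose aX : Omega n m := exist (fun Y : {set 'I_n} => #|Y|%:Z == m) _ cY.
rewrite (bigD1 aX) /=; last exact: subsetUr.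
rewrite ffunE /= setU11 tX big1 ?addr0 // => Y /andP[sXY neY].
rewrite ffunE; case: andP => // -[aY tY]; case/eqP: neY; apply: val_inj => /=.
apply/esym/eqP; rewrite eqEcard subUset sub1set aY sXY /=.
by rewrite [#|val Y|]card_Omega cardsU1 nXa cX add1n prednK.
Qed.

End TransversalVector.

(** * The two perfect matchings of an even cycle *)

Section CycleMatchings.

Variables (n : nat) (n_even : ~~ odd n).

Lemma odd_ordS (x : 'I_n) : odd (ordS x) = ~~ odd x.
Proof. by rewrite /= odd_mod // (negPf n_even). Qed.

Lemma odd_ord_pred (x : 'I_n) : odd (ord_pred x) = ~~ odd x.
Proof. by rewrite -[x in RHS]ord_predK odd_ordS negbK. Qed.

(* The edges of the cycle on 'I_n starting at a vertex of parity b. *)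
Definition cycle_matching (b : bool) (x : 'I_n) : 'I_n :=
  if odd x == b then ordS x else ord_pred x.

Lemma odd_cycle_matching b x : odd (cycle_matching b x) = ~~ odd x.
Proof. by rewrite /cycle_matching; case: ifP; rewrite ?odd_ordS ?odd_ord_pred. Qed.

Lemma cycle_matchingK b : involutive (cycle_matching b).
Proof.
move=> x; rewrite {1}/cycle_matching odd_cycle_matching /cycle_matching.
by case: b (odd x) => [] []; rewrite ?ordSK ?ord_predK.
Qed.

Lemma cycle_matching_neq b x : cycle_matching b x != x.
Proof.
apply: contra_eqN (odd_cycle_matching b x) => /eqP ->.
by case: (odd x).
Qed.

Lemma transverse_even b :
  transverse (cycle_matching b) [set x : 'I_n | ~~ odd x].
Proof.
by apply/transverseP => x; rewrite !inE odd_cycle_matching.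
Qed.

(** The matching indexed by the parity of [x] joins [x] to its successor, so membership in [A]
    alternates along the cycle from 0. *)
Lemma transverse_both_even (A : {set 'I_n}) (a : 'I_n) :
    val a = 0%N -> a \in A -> (forall b, transverse (cycle_matching b) A) ->
  A = [set x : 'I_n | ~~ odd x].
Proof.
move=> a0 aA tA.
have alt (x : 'I_n) : (ordS x \in A) = (x \notin A).
  by have /transverseP/(_ x) := tA (odd x); rewrite /cycle_matching eqxx.
apply/setP=> -[x ltxn]; rewrite inE /=; elim: x ltxn => [|x IHx] ltxn.
  by rewrite (_ : Ordinal ltxn = a) ?aA //; apply: val_inj.
rewrite (_ : Ordinal ltxn = ordS (Ordinal (ltnW ltxn))) ?alt ?IHx //.
by apply: val_inj; rewrite /= modn_small.
Qed.

End CycleMatchings.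

(** * A kernel vector whose image under [gamma_star] after [gamma] is not in the image of
    [epsilon] *)

Section Witness.

Variables (F : fieldType) (char2 : 2%N \in [pchar F]) (m n : nat).
Hypotheses (m_gt0 : (0 < m)%N) (def_n : n = (2 * m)%N).

(** [gamma_star] is the transpose of [gamma] for the standard bilinear forms. *)
Lemma gamma_star_gamma_pairing (v w : FOmega F n m) :
  \sum_Z (gamma_star F n m (gamma F n m v) Z : F) * w Z =
    \sum_X (gamma F n m v X : F) * gamma F n m w X.
Proof.
under eq_bigr do rewrite gamma_starE mulr_suml.
rewrite (exchange_big_dep predT) //=; apply: eq_bigr => X _.
by rewrite -mulr_sumr [gamma _ _ _ w _]shadowE.
Qed.

Lemma shadow_pairing i j (z : FOmega F n i) (w : FOmega F n j) :
  \sum_X (shadow F n i j z X : F) * w X =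
    \sum_Y (z Y : F) * \sum_(X : Omega n j | val X \subset val Y) (w X : F).
Proof.
under eq_bigr do rewrite shadowE mulr_suml.
rewrite (exchange_big_dep predT) //=; apply: eq_bigr => X _.
by rewrite mulr_sumr.
Qed.

Lemma gamma_star_gamma_notin_im :
  exists2 v, v \in lker (epsilon F n m) &
    (gamma_star F n m \o gamma F n m)%VF v \notin im_epsilon F n m.
Proof.
have n_even : ~~ odd n by rewrite def_n mul2n odd_double.
have n_gt0 : (0 < n)%N by lia.
pose a := Ordinal n_gt0.
pose u b := transverse_vector F m (cycle_matching b) a.
have uK b := cycle_matchingK n_even b.
have u_neq b := cycle_matching_neq n_even b.
exists (u false).
  rewrite memv_ker; apply/eqP/ffunP=> X; rewrite ffunE shadowE.
  have [|-> _ //] := transverse_vector_sum_far char2 m_gt0 def_n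
    (uK false) (u_neq false) a (X := val X).
  by rewrite card_Omega; have := eqP (valP X); lia.
apply/negP; rewrite im_epsilonE => /memv_imgP[z _].
rewrite comp_lfunE.
move/(congr1 (fun y : FOmega F n m => \sum_Z (y Z : F) * u true Z)).
(* Pairing with [u true] kills the image of [epsilon], since each [Y] has [m + 2] points. *)
rewrite gamma_star_gamma_pairing shadow_pairing [RHS]big1 => [|Y _]; last first.
  have [|_ ->] := transverse_vector_sum_far char2 m_gt0 def_n
    (uK true) (u_neq true) a (X := val Y).
    by rewrite card_Omega; lia.
  by rewrite mulr0.
under eq_bigr do rewrite !gamma_transverse_vector //.
pose E := [set x : 'I_n | ~~ odd x].
have aE : a \in E by rewrite inE.
have cE : #|E :\ a|%:Z == m%:Z - 1.
  have := card_transverse (uK true) (transverse_even n_even true).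
  by rewrite card_ord (cardsD1 a) aE; move: #|_| => c; lia.
(* The only nonzero term: adding [a] must give a transversal of both matchings, hence the even
   vertices. *)
pose E' : Omega n (m%:Z - 1) :=
  exist (fun Y : {set 'I_n} => #|Y|%:Z == m%:Z - 1) _ cE.
rewrite (bigD1 E') //= setD11 setD1K // !transverse_even // big1 => [|X neX].
  by rewrite mulr1 addr0 => /eqP; rewrite oner_eq0.
have [aX|] := boolP (a \in val X); first by rewrite mul0r.
move=> aX; rewrite -natrM mulnb; case: andP => // -[/= t0 t1].
have eX : a |: val X = E.
  by apply: (transverse_both_even (a := a)); rewrite ?setU11 // => -[].
by case/eqP: neX; apply: val_inj; rewrite /= -eX setU1K.
Qed.

End Witness.

(** * The induced endomorphism of the subquotient *)

Lemma subquot_map_is_linear (F : fieldType) (W : vectType F)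
    (V U : {vspace W}) (f : {linear W -> W}) :
    (forall w, w \in V -> f w \in V) -> (forall w, w \in U -> f w \in U) ->
  linear (subquot_map (V := V) (U := U) f).
Proof.
move=> fV fU c x y; rewrite -[x]subquot_reprK -[y]subquot_reprK -linearP.
by rewrite !subquot_mapE // -linearP; congr (subquot_class _ _); rewrite !linearP.
Qed.

Lemma subquot_class_eq0 (F : fieldType) (W : vectType F) (V U : {vspace W})
    (v : subvs_of V) :
  subquot_class U v = 0 -> vsval v \in U.
Proof.
move=> v0; have /subquot_classP : subquot_class U v = subquot_class U 0.
  by rewrite v0 linear0.
by rewrite -linearB subr0.
Qed.

Theorem corollary4p10 (F : fieldType) (char2 : 2%N \in [pchar F])
    (m : nat) (m_gt0 : (0 < m)%N) (n : nat) (def_n : n = (2 * m)%N) :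
  let K := lker (epsilon F n m) in
  let I := im_epsilon F n m in
  let phi := (gamma_star F n m \o gamma F n m)%VF in
  [/\ (I <= K)%VS, (phi @: K <= K)%VS, (phi @: I <= I)%VS
    & exists theta : {linear H F n m -> H F n m},
        [/\ subquot_induced phi theta,
            FSn_hom (H_act F n m) (H_act F n m) theta,
            ~ theta =1 \0
          & theta \o theta =1 \0]].
Proof.
move=> K I phi.
have phiK : (phi @: K <= K)%VS.
  by apply: gamma_star_gamma_stable => s v; apply: lker_epsilon_act.
have phiI : (phi @: I <= I)%VS.
  by apply: gamma_star_gamma_stable => s v; apply: im_epsilon_act.
split=> //; first exact: im_epsilon_sub_ker.
have fK w : w \in K -> phi w \in K by move=> wK; rewrite (subvP phiK) ?memv_img.
have fI w : w \in I -> phi w \in I by move=> wI; rewrite (subvP phiI) ?memv_img.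
pose theta0 : H F n m -> H F n m := subquot_map phi.
have theta0E (v : subvs_of K) :
    theta0 (subquot_class I v) = subquot_class I (vsproj K (phi (vsval v))).
  exact: subquot_mapE.
pose theta0L := GRing.isLinear.Build _ _ _ _ theta0 (subquot_map_is_linear fK fI).
pose theta : {linear H F n m -> H F n m} := HB.pack theta0 theta0L.
have thetaE v :
    theta (subquot_class I v) = subquot_class I (vsproj K (phi (vsval v))).
  exact: theta0E.
have classE (x : H F n m) : exists v, x = subquot_class I v.
  by exists (subquot_repr x); rewrite subquot_reprK.
exists theta; split.
- by move=> v w def_w; rewrite thetaE -def_w vsvalK.
- move=> x s; have [v ->] := classE x.
  rewrite [H_act _ _ _ _ _ in LHS]H_act_class !thetaE [RHS]H_act_class.
  rewrite !vsprojK ?fK ?lker_epsilon_act ?subvsP //=.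
  by rewrite gamma_star_gamma_act.
- have [v vK phiv] := gamma_star_gamma_notin_im char2 m_gt0 def_n.
  move=> /(_ (subquot_class I (vsproj K v))).
  rewrite thetaE /= vsprojK // => /subquot_class_eq0.
  by rewrite vsprojK ?fK //; apply/negP.
move=> x; have [v ->] := classE x.
rewrite -[LHS]/(theta (theta _)) !thetaE vsprojK ?fK ?subvsP //.
(* The square vanishes already before passing to classes. *)
have /lfunP/(_ (vsval v)) := gamma_star_gamma_sqr char2 m_gt0 def_n.
by rewrite comp_lfunE zero_lfunE => ->; rewrite !linear0.
Qed.
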